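(* For each integer $n\ge 0$ let $E_{\mathrm{ind}}(n)$ denote the number of partitions $\lambda$ of $n$ into odd parts with $\mathrm{ind}(\lambda)$ odd minus the number of partitions $\lambda$ of $n$ into odd parts with $\mathrm{ind}(\lambda)$ even. Then, as formal power series in $q$, $$\sum_{n\ge 0}(-1)^{\lceil n/2\rceil}E_{\mathrm{ind}}(n)\,q^n=\prod_{n=1}^{\infty}\frac{1}{1+(-1)^n q^{2n-1}}.$$
   Context: A partition of $n$ is a weakly decreasing finite sequence of positive integers with sum $n$; the empty sequence is the only partition of $0$. Meander: given two compositions (or partitions) $\lambda=(\lambda_1,\dots,\lambda_r)$ and $\mu=(\mu_1,\dots,\mu_s)$ of $n$, the meander of type $\frac{\lambda}{\mu}$ is the graph on $n$ vertices placed in a row, with the following edges. Split the row into consecutive blocks of sizes $\lambda_1,\dots,\lambda_r$, and name the vertices of the $i$-th block, in order, $v_{i,1},\dots,v_{i,\lambda_i}$; for each $i$ and each $1\le j\le\lfloor\lambda_i/2\rfloor$ add a ''top'' edge joining $v_{i,j}$ and $v_{i,\lambda_i+1-j}$. Do the same with $\mu$ in place of $\lambda$ to get ''bottom'' edges. If a top edge and a bottom edge join the same two vertices, both are kept and they form a cycle (of length 2). Every connected component is a cycle or a path, an isolated vertex being counted as a path. Define $$\mathrm{ind}_\mu(\lambda)=2C+P-1,$$ where $C$ and $P$ are the numbers of cycles and paths of the meander. (By a theorem of Dergachev and Kirillov this is the index of the seaweed Lie algebra of type $\frac{\lambda}{\mu}$ in $\mathfrak{sl}_n$.) Index of a partition: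 for $\lambda$ a partition of $n\ge1$, $\mathrm{ind}(\lambda):=\mathrm{ind}_\mu(\lambda)$ where $\mu=(n)$ is the one-part partition. For the empty partition, $\mathrm{ind}(\emptyset):=-1$. *)

(* Defs.v *)
From mathcomp Require Import all_boot all_order all_algebra.

Set Implicit Arguments.
Unset Strict Implicit.
Unset Printing Implicit Defensive.

Import Order.TTheory GRing.Theory Num.Theory.

Local Open Scope nat_scope.

Definition is_partition (n : nat) (s : seq nat) : bool :=
  [&& sorted geq s, all (leq 1) s & sumn s == n].

(* Vertices are numbered from 0, so that block i of s starts at
   sumn (take i s); with j counted from 0, v_{i,j+1} is at offset j of that
   block and v_{i,s_i+1-(j+1)} is at offset s_i - 1 - j. *)
Definition block_arc (s : seq nat) (x y : nat) : bool :=
  [exists i : 'I_(size s), exists j : 'I_(nth 0 s i)./2,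
     (x == sumn (take i s) + j)
       && (y == sumn (take i s) + (nth 0 s i - 1 - j))].

Definition block_edge (s : seq nat) (x y : nat) : bool :=
  block_arc s x y || block_arc s y x.

Section Meander.

Variables (n : nat) (lam mu : seq nat).

(* Number of edges joining x and y: a coinciding top and bottom edge count
   twice. *)
Definition edge_mult (x y : 'I_n) : nat :=
  block_edge lam x y + block_edge mu x y.

Definition adjacent : rel 'I_n := [rel x y | 0 < edge_mult x y].

Definition components : {set {set 'I_n}} :=
  [set [set y | connect adjacent x y] | x : 'I_n].

Definition joins (x y : 'I_n) (e : 'I_n * 'I_n) : bool :=
  (e == (x, y)) || (e == (y, x)).

(* The edges with both ends in S are, with multiplicity, the pairs listed
   in es. *)
Definition edges_are (S : {set 'I_n}) (es : seq ('I_n * 'I_n)) : bool :=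
  [forall x in S, forall y in S, edge_mult x y == count (joins x y) es].

(* The vertices of S can be ordered as v_1, ..., v_k so that the edges are
   v_1 v_2, ..., v_{k-1} v_k. *)
Definition is_path (S : {set 'I_n}) : bool :=
  has (fun p => edges_are S (zip p (behead p))) (permutations (enum S)).

(* Same with the additional edge v_k v_1; for k = 2 this is a double edge, and
   k = 1 is impossible since edge_mult x x = 0. *)
Definition is_cycle (S : {set 'I_n}) : bool :=
  has (fun p => edges_are S (zip p (rot 1 p))) (permutations (enum S)).

Definition num_cycles : nat := #|[set S in components | is_cycle S]|.
Definition num_paths : nat := #|[set S in components | is_path S]|.

Definition ind_wrt : int := (2 * num_cycles%:Z + num_paths%:Z - 1)%R.

End Meander.

Definition ind (lam : seq nat) : int :=
  if lam is [::] then (-1)%R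
  else ind_wrt (sumn lam) lam [:: sumn lam].

(* A partition of n has at most n parts, each at most n, hence the finite type
   n.-bseq 'I_n.+1; see partition_bseq. *)
Definition odd_partitions (n : nat) : {set n.-bseq 'I_n.+1} :=
  [set s : n.-bseq 'I_n.+1 | is_partition n (map val s) && all odd (map val s)].

Definition E_ind (n : nat) : int :=
  (#|[set s in odd_partitions n | ~~ (2 %| ind (map val s))%Z]|%:Z
   - #|[set s in odd_partitions n | (2 %| ind (map val s))%Z]|%:Z)%R.

Lemma partition_bseq (n : nat) (s : seq nat) :
  is_partition n s -> exists t : n.-bseq 'I_n.+1, map val t = s.
Proof.
case/and3P=> _ s_gt0 /eqP sum_s.
have size_s : size s <= n.
  rewrite -sum_s; elim: s s_gt0 {sum_s} => //= x s IHs /andP[x_gt0 /IHs].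
  by rewrite -add1n; apply: leq_add.
have le_s : all (gtn n.+1) s.
  apply/allP=> x s_x /=; rewrite ltnS -sum_s.
  by rewrite (perm_sumn (perm_to_rem s_x)) /= leq_addr.
have size_t : size (map (@inord n) s) <= n by rewrite size_map.
exists (Bseq size_t) => /=; rewrite -map_comp -[RHS]map_id.
by apply/eq_in_map=> x /(allP le_s) /= x_n; rewrite inordK.
Qed.

Local Open Scope ring_scope.

(* Formal power series over the integers, as coefficient sequences. *)
Definition fps : Type := nat -> int.

Definition fps_one : fps := fun k => (k == 0%N)%:R.

Definition fps_mul (f g : fps) : fps :=
  fun k => \sum_(i < k.+1) f i * g (k - i)%N.

(* The coefficients 0, ..., m of 1 / f, from
   f_0 b_{m+1} = - (f_1 b_m + ... + f_{m+1} b_0). *)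
Fixpoint fps_inv_coefs (f : fps) (m : nat) : seq int :=
  if m is m'.+1 then
    let b := fps_inv_coefs f m' in
    rcons b (- (f 0%N)^-1 * \sum_(i < m) f i.+1 * b`_(m' - i)%N)
  else [:: (f 0%N)^-1].

Definition fps_inv (f : fps) : fps := fun k => (fps_inv_coefs f k)`_k.

(* The infinite product of the G n, n >= 1, converges to f: each coefficient
   of the partial products is eventually that of f. *)
Definition is_fps_infprod (G : nat -> fps) (f : fps) : Prop :=
  forall k : nat, exists N : nat, forall M : nat, (N <= M)%N ->
    (\big[fps_mul/fps_one]_(1 <= n < M.+1) G n) k = f k.

(* 1 + (-1)^n q^(2n-1), for n >= 1 *)
Definition denom (n : nat) : fps :=
  fun k => (k == 0%N)%:R + (-1) ^+ n * (k == (2 * n - 1)%N)%:R.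

Lemma size_fps_inv_coefs f m : size (fps_inv_coefs f m) = m.+1.
Proof. by elim: m => //= m IHm; rewrite size_rcons IHm. Qed.

Lemma nth_fps_inv_coefs f m i :
  (i <= m)%N -> (fps_inv_coefs f m)`_i = fps_inv f i.
Proof.
elim: m => [|m IHm]; first by rewrite leqn0 => /eqP->.
rewrite leq_eqVlt => /predU1P[-> //|]; rewrite ltnS => le_im.
by rewrite /= nth_rcons size_fps_inv_coefs ltnS le_im IHm.
Qed.

Lemma fps_mulV f : f 0%N \is a GRing.unit -> fps_mul f (fps_inv f) =1 fps_one.
Proof.
move=> Uf [|m]; first by rewrite /fps_mul big_ord1 /= divrr.
rewrite /fps_mul big_ord_recl subn0 {1}/fps_inv /=.
rewrite nth_rcons size_fps_inv_coefs ltnn eqxx mulNr mulrN mulVKr //.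
apply/eqP; rewrite addrC subr_eq0; apply/eqP/eq_bigr => i _.
by rewrite nth_fps_inv_coefs ?leq_subr // /bump add1n subSS.
Qed.

(* Main.v *)
Require Import Defs.
From mathcomp Require Import all_boot all_order all_algebra.
From mathcomp Require Import zify.

(** The top and bottom edges of a meander are the moved points of two
    involutions of the vertices, the reflections of the blocks.  A component
    with a point fixed by one of them is a path, traced by applying the two
    involutions alternately; a path has exactly two fixed points (counted with
    the involution), a cycle none.  The reflections fix one point per odd
    block, so for a partition of [n] into [r] odd parts the number of paths is
    [(r + (n mod 2)) / 2 = ceil (r / 2)].  Hence a partition into parts
    [2 k_i - 1] contributes to [(-1)^ceil(n/2) E_ind n] the sign
    [(-1)^(ceil (n/2) + ceil (r/2)) = prod_i (-1)^(k_i - 1)], which is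
    multiplicative in the parts: this is the expansion of the product. *)

Set Implicit Arguments.
Unset Strict Implicit.
Unset Printing Implicit Defensive.

Import GRing.Theory.

Local Open Scope nat_scope.

(** * Walks that apply two involutions alternately *)

Section AlternatingWalk.

Variables (T : finType) (f g : T -> T) (x0 : T).
Hypotheses (fK : involutive f) (gK : involutive g) (fx0 : f x0 = x0).

Definition turn (k : nat) : T -> T := if odd k then f else g.

(* With [f x0 = x0] this runs along the component of [x0] from one end. *)
Fixpoint walk (k : nat) : T := if k is j.+1 then turn j (walk j) else x0.

Lemma turnK k : involutive (turn k).
Proof. by rewrite /turn; case: odd. Qed.

Lemma turn_walkS k : turn k (walk k.+1) = walk k.
Proof. exact: turnK. Qed.

Lemma turn_odd i j : odd i = odd j -> turn i = turn j.
Proof. by rewrite /turn => ->. Qed.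

(** The forward turn at [i] and the turn undoing the step into [i + d] agree when [d] is odd.
    Applying it moves both ends inward by one, until two consecutive positions coincide. *)
Lemma walk_odd_period d i : odd d -> walk i = walk (i + d) ->
  exists2 m, m < i + d & walk m.+1 = walk m.
Proof.
elim/ltn_ind: d i => -[|[|d]] // IH i d_odd.
  by rewrite addn1 => /esym E; exists i.
rewrite !addnS => /(congr1 (turn i)).
rewrite {2}(@turn_odd i (i + d).+1); last by lia.
rewrite turn_walkS -/(walk i.+1) -addSn => /IH[] //; first by rewrite /= negbK in d_odd.
by move=> m lt_m E; exists m => //; lia.
Qed.

(** For even [d] the steps into [i] and into [i + d] use the same involution, so undoing both shifts
    the coincidence down to [walk 0 = walk d]. The step into [d] is by [f], which fixes [x0], so it
    does not move. *)
Lemma walk_even_period d i : ~~ odd d -> 0 < d -> walk i = walk (i + d) ->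
  exists2 m, m < i + d & walk m.+1 = walk m.
Proof.
move=> d_even d_gt0; elim: i => [|i IH].
  case: d d_even d_gt0 => [|[|d]] //= /negPn d_even _ E; exists d.+1 => //.
  rewrite -[RHS]turn_walkS -/(walk 0) /= -E /= /turn /=.
  by move: d_even; case: odd.
rewrite addSn => /(congr1 (turn i)); rewrite turn_walkS (@turn_odd i (i + d)).
  by rewrite turn_walkS => /IH[m lt_m E]; exists m => //; lia.
by rewrite oddD (negbTE d_even) addbF.
Qed.

Lemma walk_inj k : (forall j, j < k -> walk j.+1 != walk j) ->
  {in gtn k.+1 &, injective walk}.
Proof.
move=> moves.
have aux i j : i < j -> j <= k -> walk i = walk j -> False.
  move=> lt_ij le_jk; rewrite -(subnKC (ltnW lt_ij)) => E.
  have [m lt_m /eqP] : exists2 m, m < i + (j - i) & walk m.+1 = walk m.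
    have [|] := boolP (odd (j - i)) => d_par; first exact: walk_odd_period.
    by apply: walk_even_period; rewrite ?subn_gt0.
  by apply/negP/moves; lia.
move=> i j; rewrite !inE !ltnS => le_ik le_jk E.
by case: (ltngtP i j) => // lt_ij; [case: (aux i j) | case: (aux j i)].
Qed.

(** Pigeonhole: if the first [#|T|] steps all moved, [walk] would take [#|T|.+1] distinct values. *)
Lemma walk_stops : exists k, walk k.+1 == walk k.
Proof.
have [/hasP[k _ E]|/hasPn moves] :=
  boolP (has (fun k => walk k.+1 == walk k) (iota 0 #|T|)); first by exists k.
have inj : {in gtn #|T|.+1 &, injective walk}.
  by apply: walk_inj => j lt_j; apply: moves; rewrite mem_iota.
have := uniq_leq_size (introT (mkseq_uniqP _ _) inj) (fun x _ => mem_enum predT x).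
by rewrite size_mkseq -cardE ltnn.
Qed.

End AlternatingWalk.

(** * A component containing a fixed point is a path *)

Section PathComponent.

Variables (n : nat) (lam mu : seq nat) (f g : 'I_n -> 'I_n).
Hypotheses (fK : involutive f) (gK : involutive g).
Hypothesis edgeE : forall x y, edge_mult lam mu x y =
  ((f x == y) && (x != y)) + ((g x == y) && (x != y)).

Local Notation adj := (@adjacent n lam mu).

Lemma adjacent_sym : symmetric adj.
Proof.
move=> x y; rewrite /adjacent /= !edgeE.
by rewrite (inv_eq fK x) (inv_eq gK x) !(eq_sym x).
Qed.

Lemma connect_adjacent_sym : connect_sym adj.
Proof. exact: sym_connect_sym adjacent_sym. Qed.

Lemma adjacent_turn (h : 'I_n -> 'I_n) x :
  h =1 f \/ h =1 g -> connect adj x (h x).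
Proof.
have [<- //|ne_xhx] := eqVneq x (h x).
move=> hE; apply: connect1; rewrite /adjacent /= edgeE ne_xhx !andbT.
by case: hE => <-; rewrite eqxx ?addn1.
Qed.

Lemma closed_connect (A : pred 'I_n) x y :
  (forall z, A z -> A (f z) && A (g z)) -> A x -> connect adj x y -> A y.
Proof.
move=> closedA Ax /connectP[p p_path ->]; elim: p x Ax p_path => //= z p IH x Ax.
case/andP=> xz; apply: IH; move: xz; rewrite /adjacent /= edgeE.
have /andP[Af Ag] := closedA x Ax.
by case: (f x =P z) => [<- //|_]; case: (g x =P z) => [<- //|].
Qed.

(** The walk from [x0], cut at its first stationary step [k], lists distinct vertices. The list is
    closed under [f] and [g], hence exhausts the component, and its consecutive pairs are exactly
    the edges. *)
Lemma is_path_component_fix x0 : f x0 = x0 -> is_path lam mu [set y | connect adj x0 y].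
Proof.
move=> fx0; have [k /eqP stop moves] := ex_minnP (walk_stops fK gK fx0).
set u := walk f g x0; pose h := turn f g.
have u_inj : {in gtn k.+1 &, injective u}.
  apply: walk_inj => // j lt_jk; apply/negP => /moves; lia.
have memE y : y \in mkseq u k.+1 -> exists2 i, i <= k & y = u i.
  by case/mapP=> i; rewrite mem_iota => lt_ik ->; exists i.
have walk_in i : i <= k -> u i \in mkseq u k.+1.
  by move=> le_ik; apply: map_f; rewrite mem_iota.
have u_next i : i <= k -> h i (u i) = if i < k then u i.+1 else u i.
  rewrite leq_eqVlt => /predU1P[->|->] //; rewrite ltnn; exact: stop.
(* [h i.+1] has the parity of the step into position [i], so it goes back; at [i = 0] it is [f],
   which fixes [x0]. *)
have u_prev i : i <= k -> h i.+1 (u i) = if 0 < i then u i.-1 else u i.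
  case: i => [|i] _; first by rewrite /h /turn /=.
  by rewrite /h (@turn_odd _ f g i.+2 i) ?turn_walkS //=; lia.
(* [f] and [g] are [h i] and [h i.+1] in an order depending on the parity of [i]; a symmetric sum
   avoids distinguishing the two orders. *)
have fgE i (Q : 'I_n -> nat) :
    Q (f (u i)) + Q (g (u i)) = Q (h i (u i)) + Q (h i.+1 (u i)).
  by rewrite /h /turn /=; case: (odd i); rewrite //= addnC.
have fg_in i : i <= k -> (f (u i) \in mkseq u k.+1) && (g (u i) \in mkseq u k.+1).
  move=> le_ik; have := fgE i (fun y => y \in mkseq u k.+1).
  have -> : h i (u i) \in mkseq u k.+1.
    by rewrite u_next //; case: ifP => lt_ik; apply: walk_in.
  have -> : h i.+1 (u i) \in mkseq u k.+1.
    by rewrite u_prev //; case: ifP => _; apply: walk_in; lia.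
  by do 2!case: (_ \in _).
apply/hasP; exists (mkseq u k.+1).
  rewrite mem_permutations; apply: uniq_perm; rewrite ?enum_uniq //.
    exact/mkseq_uniqP.
  move=> y; rewrite mem_enum in_set; apply/idP/idP => [/memE[i _ ->]|].
    elim: i => [|i IH]; first exact: connect0.
    apply: connect_trans IH _; apply: adjacent_turn.
    by rewrite /turn; case: odd; [left | right].
  apply: closed_connect (walk_in 0 isT) => z /memE[i le_ik ->]; exact: fg_in.
have edges :
    zip (mkseq u k.+1) (behead (mkseq u k.+1)) =
    mkseq (fun l => (u l, u l.+1)) k.
  apply: (@eq_from_nth _ (x0, x0)).
    by rewrite size_zip size_behead !size_mkseq; lia.
  move=> i; rewrite size_zip size_behead !size_mkseq => lt_i.
  rewrite nth_zip_cond size_zip size_behead !size_mkseq lt_i nth_behead.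
  by rewrite !nth_mkseq //; lia.
have u_eq i j : i <= k -> j <= k -> (u i == u j) = (i == j).
  move=> le_ik le_jk; apply/eqP/eqP => [|-> //]; exact: u_inj.
have in_u y : connect adj x0 y -> exists2 i, i <= k & y = u i.
  move=> xy; apply/memE; apply: closed_connect (walk_in 0 isT) xy => z /memE[i le_ik ->].
  exact: fg_in.
apply/forallP=> x; apply/implyP; rewrite inE => /in_u[i le_ik ->].
apply/forallP=> y; apply/implyP; rewrite inE => /in_u[j le_jk ->].
(* The condition that edge number [l], from [u l] to [u l.+1], joins [u i] and [u j], written on
   indices. *)
pose joined l := (l == i) && (i.+1 == j) || (l == j) && (j.+1 == i).
rewrite edgeE edges count_map (eq_in_count (a2 := joined)); last first.
  move=> l; rewrite mem_iota => lt_l.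
  rewrite /joined /joins /= !xpair_eqE -![turn f g l (u l)]/(u l.+1) !u_eq; lia.
rewrite (fgE i (fun z => (z == u j) && (u i != u j))) u_next // u_prev // u_eq //.
(* At the ends [i = k] and [i = 0] a turn fixes [u i], and the condition [u i != u j] removes the
   resulting term. *)
apply/eqP; transitivity ((i.+1 == j) + (j.+1 == i)).
  case: ifP => lt_ik; case: ifP => i_gt0; rewrite !u_eq; lia.
have count_eq l : count (pred1 l) (iota 0 k) = (l < k).
  by rewrite count_uniq_mem ?iota_uniq // mem_iota.
have [ij|ij] := eqVneq i.+1 j; have [ji|ji] := eqVneq j.+1 i; first lia.
- by rewrite (@eq_count _ _ (pred1 i)) ?count_eq => [|l]; rewrite ?/joined /=; lia.
- by rewrite (@eq_count _ _ (pred1 j)) ?count_eq => [|l]; rewrite ?/joined /=; lia.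
- by rewrite (@eq_count _ _ pred0) ?count_pred0 // => l; rewrite /joined /=; lia.
Qed.

End PathComponent.

(** * Counting paths by fixed points *)

Lemma sum_joins n (S : {set 'I_n}) (e : 'I_n * 'I_n) :
  e.1 \in S -> e.2 \in S -> e.1 != e.2 ->
  \sum_(x in S) \sum_(y in S) joins x y e = 2.
Proof.
case: e => a b /= Sa Sb ne_ab.
have sum1 z : z \in S -> \sum_(y in S) (z == y) = 1.
  move=> Sz; rewrite (bigD1 z) //= eqxx big1 // => y /andP[_].
  by rewrite eq_sym => /negbTE->.
have joinsE x y : joins x y (a, b) = (a == x) * (b == y) + (b == x) * (a == y) :> nat.
  rewrite /joins !xpair_eqE; move: ne_ab.
  by case: (a =P x) => [->|_]; case: (b =P x) => [->|_];
    rewrite ?eqxx ?mul1n ?mul0n ?addn0 ?andbF ?orbF ?andbT.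
under eq_bigr => x _.
  under eq_bigr => y _ do rewrite joinsE.
  rewrite big_split -!big_distrr /= !sum1 // !muln1.
  over.
by rewrite big_split /= !sum1.
Qed.

Section PathCount.

Variables (n : nat) (lam mu : seq nat) (f g : 'I_n -> 'I_n).
Hypotheses (fK : involutive f) (gK : involutive g).
Hypothesis edgeE : forall x y, edge_mult lam mu x y =
  ((f x == y) && (x != y)) + ((g x == y) && (x != y)).

Local Notation adj := (@adjacent n lam mu).

(** A fixed point of [f] or of [g] can serve as the start of a walk, which would make the component
    a path; for [g] the two involutions exchange roles. *)
Lemma component_nonpath_deficiency S : S \in components n lam mu ->
  ~~ is_path lam mu S -> \sum_(x in S) ((f x == x) + (g x == x)) = 0.
Proof.
case/imsetP=> x _ -> not_path; apply: big1 => y; rewrite in_set => xy.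
have csym : connect_sym adj := connect_adjacent_sym fK gK edgeE.
have compE : [set z | connect adj x z] = [set z | connect adj y z].
  by apply/setP=> z; rewrite !in_set (same_connect csym xy).
case: eqP => [fy|_].
  by case/negP: not_path; rewrite compE; exact: (is_path_component_fix fK gK edgeE fy).
case: eqP => [gy|//]; case/negP: not_path; rewrite compE.
by apply: (is_path_component_fix gK fK) gy => u v; rewrite edgeE addnC.
Qed.

(** Double counting: the degrees in [S] sum to [2 * #|S|] minus the number of fixed points, and also
    to twice the [#|S|.-1] edges of the path. *)
Lemma component_path_deficiency S : S \in components n lam mu ->
  is_path lam mu S -> \sum_(x in S) ((f x == x) + (g x == x)) = 2.
Proof.
case/imsetP=> x _ S_def /hasP[p].
rewrite mem_permutations => pS /forallP edges.
have Sp y : (y \in p) = (y \in S) by rewrite (perm_mem pS) mem_enum.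
have p_uniq : uniq p by rewrite (perm_uniq pS) enum_uniq.
have size_p : size p = #|S| by rewrite (perm_size pS) -cardE.
have S_gt0 : 0 < #|S| by apply/card_gt0P; exists x; rewrite S_def in_set connect0.
have closedS y : y \in S -> (f y \in S) && (g y \in S).
  rewrite S_def !in_set => xy.
  by rewrite !(connect_trans xy) //; apply: adjacent_turn edgeE _ _ _; [right|left].
(* At each vertex, each of [f] and [g] either fixes it or provides one edge with its other end in
   [S]. *)
have degE : \sum_(y in S) ((f y == y) + (g y == y)) +
    \sum_(y in S) \sum_(z in S) edge_mult lam mu y z = 2 * #|S|.
  rewrite -big_split mulnC -sum_nat_const; apply: eq_bigr => y Sy /=.
  have /andP[Sf Sg] := closedS y Sy.
  have sum1 z : z \in S -> \sum_(w in S) ((z == w) && (y != w)) = (z != y).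
    move=> Sz; rewrite (bigD1 z) //= eqxx /= big1 ?addn0; first by rewrite eq_sym.
    by move=> w /andP[_]; rewrite eq_sym => /negbTE->.
  rewrite (eq_bigr _ (fun z _ => edgeE y z)) big_split /= !sum1 //.
  by do 2!case: eqP.
have sumE : \sum_(y in S) \sum_(z in S) edge_mult lam mu y z = 2 * #|S|.-1.
  have -> : \sum_(y in S) \sum_(z in S) edge_mult lam mu y z =
     \sum_(y in S) \sum_(z in S) \sum_(e <- zip p (behead p)) joins y z e.
    apply: eq_bigr => y Sy; apply: eq_bigr => z Sz.
    have /forallP/(_ z) := implyP (edges y) Sy; rewrite Sz => /eqP ->.
    by rewrite -sum1_count big_mkcond; apply: eq_bigr => e _; case: joins.
  (* Summing over edges first, each edge accounts for two ordered pairs of vertices. *)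
  rewrite (eq_bigr _ (fun y _ => exchange_big _ _ _ _ _ _)) exchange_big /=.
  rewrite (eq_big_seq (fun _ => 2)).
    by rewrite big_const_seq count_predT iter_addn_0 size_zip size_behead
      size_p (minn_idPr (leq_pred _)).
  move=> e /(nthP (x, x))[i]; rewrite size_zip size_behead => lt_i <-.
  rewrite nth_zip_cond size_zip size_behead lt_i nth_behead.
  have lt_ip : i.+1 < size p.
    by move: lt_i; rewrite leq_min => /andP[_]; rewrite ltn_predRL.
  apply: sum_joins => /=; rewrite -?Sp ?mem_nth ?(ltnW lt_ip) //.
  by rewrite nth_uniq ?(ltnW lt_ip) // neq_ltn leqnn.
by move: degE; rewrite sumE -[in RHS](prednK S_gt0) mulnS => /addIn.
Qed.

Lemma double_num_paths :
  2 * num_paths n lam mu = \sum_(x : 'I_n) ((f x == x) + (g x == x)).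
Proof.
have csym : connect_sym adj := connect_adjacent_sym fK gK edgeE.
have part : partition (components n lam mu) setT.
  have -> : components n lam mu = equivalence_partition (connect adj) setT.
    rewrite /components /equivalence_partition.
    apply/setP=> S; apply/imsetP/imsetP => -[x _ ->]; exists x => //;
    by apply/setP=> y; rewrite !in_set.
  apply/equivalence_partitionP => x y z _ _ _; split; first exact: connect0.
  by move=> xy; apply: same_connect.
transitivity (\sum_(x in setT) ((f x == x) + (g x == x))); last first.
  by apply: eq_bigl => x; rewrite in_setT.
rewrite (set_partition_big _ part) /num_paths -sum1_card big_distrr /=.
under eq_bigl => S do rewrite in_set.
rewrite big_mkcondr; apply: eq_bigr => S S_comp.
by case: ifPn => [/component_path_deficiency|/component_nonpath_deficiency] ->.
Qed.

End PathCount.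

(** * Block reflections and their fixed points *)

Fixpoint block_flip (s : seq nat) (x : nat) : nat :=
  if s is a :: s' then
    if x < a then a - 1 - x else a + block_flip s' (x - a)
  else x.

Lemma block_flip_lt s x : x < sumn s -> block_flip s x < sumn s.
Proof.
elim: s x => //= a s IH x lt_x; case: (ltnP x a) => le_ax; first lia.
by rewrite ltn_add2l; apply: IH; lia.
Qed.

Lemma block_flipK s : involutive (block_flip s).
Proof.
elim: s => //= a s IH x; case: (ltnP x a) => le_ax; first by rewrite ifT; lia.
by rewrite ifF ?addKn ?IH; lia.
Qed.

Lemma block_arcP s x y :
  reflect (exists i j, [/\ i < size s, j < (nth 0 s i)./2,
             x = sumn (take i s) + j & y = sumn (take i s) + (nth 0 s i - 1 - j)])
          (block_arc s x y).
Proof.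
apply: (iffP existsP) => [[i /existsP[j /andP[/eqP-> /eqP->]]]|].
  by exists i, j; split.
case=> i [j [lt_i lt_j -> ->]]; exists (Ordinal lt_i); apply/existsP.
by exists (Ordinal lt_j); rewrite /= !eqxx.
Qed.

Lemma block_arc_cons a s x y :
  block_arc (a :: s) x y =
  (x < a./2) && (y == a - 1 - x)
  || [&& a <= x, a <= y & block_arc s (x - a) (y - a)].
Proof.
apply/block_arcP/idP.
  case=> -[|i] [j [/= lt_i lt_j -> ->]]; first by rewrite !add0n lt_j eqxx.
  apply/orP; right; rewrite -!addnA !leq_addr !addKn /=; apply/block_arcP.
  by exists i, j.
case/orP=> [/andP[lt_x /eqP->]|/and3P[le_ax le_ay /block_arcP[i [j [lt_i lt_j Ex Ey]]]]].
  by exists 0, x.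
exists i.+1, j; split=> //=; lia.
Qed.

(** Reflecting a block exchanges its lower and upper halves along the arcs; [x != y] discards the
    centre of an odd block, which carries no arc. *)
Lemma block_edgeE s x y : x < sumn s -> y < sumn s ->
  block_edge s x y = (block_flip s x == y) && (x != y).
Proof.
elim: s x y => //= a s IH x y lt_x lt_y.
rewrite /block_edge !block_arc_cons.
have [lt_xa|le_ax] := ltnP x a; have [lt_ya|le_ya] := ltnP y a; rewrite ?andbF ?orbF /=.
- lia.
- by lia.
- by lia.
have {IH} := IH (x - a) (y - a); rewrite /block_edge.
have -> : (x < a./2) = false by lia.
have -> : (y < a./2) = false by lia.
move=> /= ->; lia.
Qed.

Lemma sum_block_flip_fixed s :
  \sum_(x < sumn s) (block_flip s x == x) = count odd s.
Proof.
elim: s => [|a s IH] /=; first by rewrite big_ord0.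
rewrite big_split_ord /= -IH; congr (_ + _); last first.
  apply: eq_bigr => x _.
  by rewrite ltnNge leq_addr /= addKn eqn_add2l.
(* The equation [a - 1 - i = i] is solvable only for odd [a], and then only by the centre [a./2]. *)
have -> : \sum_(i < a) ((if i < a then a - 1 - i else a + block_flip s (i - a)) == i)
   = \sum_(i < a) (odd a && (i == a./2 :> nat)).
  by apply: eq_bigr => i _; rewrite ltn_ord; have := ltn_ord i; lia.
have [a_odd|a_even] := boolP (odd a); last by rewrite big1.
have lt_a : a./2 < a by lia.
rewrite (bigD1 (Ordinal lt_a)) //= eqxx big1 // => i.
by rewrite -val_eqE /= => /negbTE->.
Qed.

Section Flip.

Variable n : nat.

(** When [sumn s = n], [block_flip_lt] ensures that the default value [x] is never taken. *)
Definition ord_flip (s : seq nat) (x : 'I_n) : 'I_n := insubd x (block_flip s x).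

Lemma val_ord_flip s x : sumn s = n -> val (ord_flip s x) = block_flip s x.
Proof.
move=> sum_s; have := @block_flip_lt s x; rewrite sum_s => /(_ (ltn_ord x)) lt_n.
by rewrite val_insubd lt_n.
Qed.

Lemma ord_flipK s : sumn s = n -> involutive (ord_flip s).
Proof. by move=> sum_s x; apply: val_inj; rewrite !val_ord_flip // block_flipK. Qed.

Lemma num_paths_count lam mu : sumn lam = n -> sumn mu = n ->
  2 * num_paths n lam mu = count odd lam + count odd mu.
Proof.
move=> sum_lam sum_mu.
have flipE s (x y : 'I_n) : sumn s = n ->
    block_edge s x y = (ord_flip s x == y) && (x != y).
  move=> sum_s; rewrite block_edgeE ?sum_s //.
  by rewrite -!val_eqE val_ord_flip.
rewrite (double_num_paths (ord_flipK sum_lam) (ord_flipK sum_mu)); last first.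
  by move=> x y; rewrite /edge_mult !flipE.
rewrite big_split /= -(sum_block_flip_fixed lam) -(sum_block_flip_fixed mu).
rewrite sum_lam sum_mu; congr (_ + _); apply: eq_bigr => x _;
by rewrite -val_eqE val_ord_flip.
Qed.

End Flip.


(** * Parity of the index for odd parts *)

Lemma count_odd_all s : all odd s -> count odd s = size s.
Proof. by rewrite all_count => /eqP. Qed.

Lemma odd_sumn s : odd (sumn s) = odd (count odd s).
Proof. by elim: s => //= a s IH; rewrite !oddD IH oddb. Qed.

Lemma num_paths_odd_parts s : all odd s ->
  num_paths (sumn s) s [:: sumn s] = uphalf (size s).
Proof.
move=> odd_s; have := @num_paths_count (sumn s) s [:: sumn s] erefl (addn0 _).
by rewrite /= addn0 odd_sumn count_odd_all //; lia.
Qed.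

(** Cycles contribute an even number, so the index has the parity of the number of paths minus one;
    the value -1 at the empty partition fits, with zero paths. *)
Lemma ind_odd_parts s : all odd s -> (2 %| ind s)%Z = odd (uphalf (size s)).
Proof.
case: s => [|a s] // odd_s; rewrite /ind /ind_wrt num_paths_odd_parts //.
lia.
Qed.

(** * Power series and multiplication by a binomial *)

Local Open Scope ring_scope.

(* Multiplication by [1 + c q^d]. *)
Definition mul_binom (c : int) (d : nat) (f : fps) : fps :=
  fun k => f k + (if (d <= k)%N then c * f (k - d)%N else 0).

Lemma eq_fps_mul f g h : g =1 h -> fps_mul f g =1 fps_mul f h.
Proof. by move=> gh k; apply: eq_bigr => i _; rewrite gh. Qed.

Lemma fps_mul1 f : fps_mul f fps_one =1 f.
Proof.
move=> k; rewrite /fps_mul big_ord_recr /= subnn big1 ?add0r ?mulr1 // => i _.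
by rewrite /fps_one subn_eq0 leqNgt ltn_ord mulr0.
Qed.

(** Lets a binomial factor pass through a product of series without appeal to general ring laws for
    [fps_mul]. *)
Lemma fps_mul_binom c d f g :
  fps_mul f (mul_binom c d g) =1 mul_binom c d (fps_mul f g).
Proof.
move=> k; rewrite /fps_mul /mul_binom.
under eq_bigr do rewrite mulrDr.
rewrite big_split /=; congr (_ + _).
case: leqP => [le_dk|lt_kd]; last first.
  by rewrite big1 // => i _; rewrite ifF ?mulr0 //; lia.
(* The shorter convolution is extended to the index range of the longer one, so that the two can be
   compared termwise. *)
rewrite (big_ord_widen k.+1 (fun i => f i * g (k - d - i)%N)) ?ltnS ?leq_subr //.
rewrite [in RHS]big_mkcond big_distrr /=; apply: eq_bigr => i _.
have -> : (i < (k - d).+1)%N = (d <= k - i)%N by have := ltn_ord i; lia.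
by case: ifP => _; rewrite ?mulr0 // mulrCA subnAC.
Qed.

Lemma fps_mul_denom n f :
  fps_mul (denom n) f =1 mul_binom ((-1) ^+ n) (2 * n - 1) f.
Proof.
move=> k; rewrite /fps_mul /mul_binom /denom.
under eq_bigr do rewrite mulrDl.
rewrite big_split /=; congr (_ + _).
  by rewrite big_ord_recl big1 ?addr0 ?mul1r ?subn0 // => i _; rewrite mul0r.
case: leqP => [le_dk|lt_kd]; last first.
  rewrite big1 // => i _; have /negbTE-> : (i != 2 * n - 1 :> nat)%N.
    by have := ltn_ord i; lia.
  by rewrite mulr0 mul0r.
have lt_d : (2 * n - 1 < k.+1)%N by [].
rewrite (bigD1 (Ordinal lt_d)) //= eqxx mulr1 big1 ?addr0 // => i.
by rewrite -val_eqE /= => /negbTE->; rewrite mulr0 mul0r.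
Qed.

Lemma mul_binom_inv n : (0 < n)%N ->
  mul_binom ((-1) ^+ n) (2 * n - 1) (fps_inv (denom n)) =1 fps_one.
Proof.
move=> n_gt0 k; rewrite -fps_mul_denom fps_mulV // /denom.
by have /negbTE-> : (0 != 2 * n - 1)%N; [lia | rewrite mulr0 addr0 unitr1].
Qed.

Definition prod_inv_denom (r : seq nat) : fps :=
  \big[fps_mul/fps_one]_(n <- r) fps_inv (denom n).

(** The binomial passes the earlier factors and cancels the last one. On coefficients this is a
    recurrence for the partial products. *)
Lemma mul_binom_prod r n : (0 < n)%N ->
  mul_binom ((-1) ^+ n) (2 * n - 1) (prod_inv_denom (rcons r n))
    =1 prod_inv_denom r.
Proof.
move=> n_gt0; rewrite /prod_inv_denom; elim: r => [|m r IH] k /=.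
  rewrite big_cons !big_nil -(mul_binom_inv n_gt0 k).
  by rewrite /mul_binom !fps_mul1.
by rewrite !big_cons -fps_mul_binom; apply: eq_fps_mul.
Qed.

(** * Signed enumeration of partitions into odd parts *)

Definition sign_weight (s : seq nat) : int := (-1) ^+ sumn (map half s).

(** Induction on [M], then strong induction on [k]. With [d = 2 * M + 1] the largest part now
    allowed, a partition either has no part [d], or starts with [d] and leaves such a partition of
    [k - d]; this mirrors the recurrence of [mul_binom_prod]. *)
Lemma odd_partition_list M k : exists L : seq (seq nat),
  [/\ uniq L,
      forall s, (s \in L) = [&& is_partition k s, all odd s & all (gtn (2 * M)) s]
    & \sum_(s <- L) sign_weight s = prod_inv_denom (iota 1 M) k].
Proof.
elim: M k => [|M IHM] k.
  exists (nseq (k == 0%N) [::]); split.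
  - by case: eqP.
  - move=> s; rewrite mem_nseq; case: s => [|a s].
      by rewrite /is_partition /= eq_sym; case: eqP.
    by rewrite andbF /= !andbF.
  - rewrite /prod_inv_denom big_nil /fps_one; case: eqP => _; last by rewrite big_nil.
    by rewrite big_seq1.
elim/ltn_ind: k => k IHk; have [d dE] : {d | d = (2 * M).+1} by eexists.
have [L1 [uL1 mL1 sL1]] := IHM k.
have := @mul_binom_prod (iota 1 M) M.+1 isT k.
rewrite -sL1 -cats1 -[[:: M.+1]]/(iota (1 + M) 1) -iotaD addn1.
rewrite /mul_binom (_ : (2 * M.+1 - 1)%N = d); last lia.
have [le_dk|lt_kd] := leqP d k; last first.
  rewrite addr0 => ->; exists L1; split=> // s; rewrite mL1.
  apply/and3P/and3P => -[sP sO sB]; split=> //; apply/allP=> a s_a.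
    by have := allP sB a s_a; rewrite /=; lia.
  have le_ak : (a <= k)%N.
    case/and3P: sP => _ _ /eqP <-.
    by rewrite (perm_sumn (perm_to_rem s_a)) /= leq_addr.
  by have := allP sB a s_a; rewrite /= => ?; have := allP sO a s_a; lia.
have [|L2 [uL2 mL2 <-]] := IHk (k - d)%N; first lia.
move=> sE; exists (L1 ++ map (cons d) L2); split.
- rewrite cat_uniq uL1 map_inj_uniq ?uL2 ?andbT; last by move=> ? ? [].
  apply/hasPn=> _ /mapP[s _ ->]; rewrite mL1 /=.
  by rewrite dE ltnNge leqW // !andbF.
- move=> s; rewrite mem_cat mL1.
  have -> : (s \in map (cons d) L2) =
      if s is a :: t then (a == d) && (t \in L2) else false.
    case: s => [|a t]; first by apply/mapP => -[].
    apply/mapP/andP => [[u Lu [-> ->]]|[/eqP-> Lt]]; last by exists t.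
    by rewrite eqxx.
  case: s => [|a t]; first by rewrite orbF.
  rewrite mL2 /is_partition /= !(path_sortedE (rev_trans leq_trans)).
  (* If the first part is not [d], being odd and below [2 * M + 2] it is below [2 * M], and
     monotonicity extends this bound to all parts. *)
  have [->|ne_ad] := eqVneq a d; last first.
    rewrite orbF.
    apply/idP/idP.
      case/and3P=> sP sO /andP[lt_a sB]; rewrite sP sO /=; apply/andP; split; first lia.
      by apply/allP=> x /(allP sB) /=; lia.
    case/and3P=> sP sO /andP[lt_a sB]; rewrite sP sO /=.
    case/andP: sO => a_odd _; have {}lt_a : (a < 2 * M)%N by lia.
    rewrite lt_a; case/and3P: sP => /andP[le_a _] _ _.
    by apply/allP=> x /(allP le_a) /=; lia.
  have -> : (d < 2 * M)%N = false by lia.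
  rewrite !andbF /=.
  have -> : (d + sumn t == k)%N = (sumn t == k - d)%N by lia.
  have -> : odd d by lia.
  have -> : (0 < d)%N by lia.
  have -> : (d < 2 * M.+1)%N by lia.
  have -> : all (geq d) t = all (gtn (2 * M.+1)) t.
    by apply: eq_all => x /=; lia.
  by rewrite /=; case: (all (gtn _) t); rewrite ?andbF ?andbT.
- rewrite big_cat big_map /= -sE.
  (* The half of [d] is [M], and [(-1) ^+ M] is the opposite of the coefficient [(-1) ^+ M.+1] of
     the binomial. *)
  have -> : \sum_(s <- L2) sign_weight (d :: s) =
      (-1) ^+ M * \sum_(s <- L2) sign_weight s.
    rewrite big_distrr; apply: eq_bigr => s _.
    by rewrite /sign_weight /= exprD; congr (_ ^+ _ * _); lia.
  by rewrite exprS mulN1r mulNr subrK.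
Qed.

(** * Comparison with the index and conclusion *)

Lemma sumn_odd_parts s : all odd s -> sumn s = (size s + (sumn (map half s)).*2)%N.
Proof. by elim: s => //= a s IH /andP[a_odd /IH->]; lia. Qed.

(** With [h] the sum of the halves, [uphalf (size s + h.*2) = uphalf (size s) + h], so the two
    exponents on the right sum to [h] modulo 2. *)
Lemma sign_weightE s : all odd s ->
  sign_weight s = (-1) ^+ uphalf (sumn s) * (-1) ^+ uphalf (size s).
Proof.
move=> odd_s; rewrite (sumn_odd_parts odd_s) -exprD /sign_weight.
rewrite -signr_odd -[RHS]signr_odd; congr (_ ^+ (nat_of_bool _)); lia.
Qed.

Lemma E_ind_sum n :
  E_ind n = \sum_(s in odd_partitions n) (-1) ^+ uphalf (size s).
Proof.
have cardZ (A : {set n.-bseq 'I_n.+1}) : #|A|%:Z = \sum_(s in A) 1.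
  by rewrite -natz -sum1_card natr_sum.
rewrite /E_ind !cardZ -sumrN.
rewrite [RHS](bigID (fun s : n.-bseq _ => (2 %| ind (map val s))%Z)) /= [RHS]addrC.
have sE (s : n.-bseq 'I_n.+1) : s \in odd_partitions n ->
    (-1) ^+ uphalf (size s) = (-1) ^+ (2 %| ind (map val s))%Z :> int.
  by rewrite inE => /andP[_ odd_s]; rewrite ind_odd_parts // size_map signr_odd.
congr (_ + _).
  apply: eq_big => s; first by rewrite in_set.
  by rewrite in_set => /andP[Os /negbTE nE]; rewrite sE // nE.
apply: eq_big => s; first by rewrite in_set.
by rewrite in_set => /andP[Os E]; rewrite sE // E.
Qed.

Theorem theorem1 :
  is_fps_infprod (fun n : nat => fps_inv (denom n))
                 (fun n : nat => (-1) ^+ uphalf n * E_ind n).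
Proof.
(* The bound [k] suffices: a part of a partition of [k] is positive and at most [k <= M], hence
   below [2 * M]. *)
move=> k; exists k => M le_kM; rewrite /index_iota subSS subn0.
rewrite -[LHS]/(prod_inv_denom (iota 1 M) k).
have [L [uL mL <-]] := odd_partition_list M k.
rewrite E_ind_sum big_distrr /=.
have -> : \sum_(s in odd_partitions k) (-1) ^+ uphalf k * (-1) ^+ uphalf (size s) =
    \sum_(s in odd_partitions k) sign_weight (map val s) :> int.
  apply: eq_bigr => s; rewrite inE => /andP[/and3P[_ _ /eqP sum_s] odd_s].
  by rewrite sign_weightE // sum_s size_map.
rewrite -big_enum -(big_map (fun s : k.-bseq 'I_k.+1 => map val s) predT sign_weight) /=.
(* Both sums run over the same partitions, listed without repetition; [partition_bseq] converts
   between the two encodings. *)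
apply: perm_big; apply: uniq_perm => //.
  rewrite map_inj_uniq ?enum_uniq // => s t E; apply: val_inj.
  exact: (inj_map val_inj) E.
move=> s; rewrite mL; apply/and3P/mapP => [[sP sO _]|[t]].
  have [t tE] := partition_bseq sP; exists t => //.
  by rewrite mem_enum inE tE sP sO.
rewrite mem_enum inE => /andP[tP tO] ->; split=> //.
case/and3P: (tP) => _ _ /eqP sum_t; apply/allP => x t_x /=.
have : (x <= k)%N by rewrite -sum_t (perm_sumn (perm_to_rem t_x)) /= leq_addr.
by have := allP tO x t_x; lia.
Qed.
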